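(* Let $(\mathcal{D},\epsilon)$ be a tensor manifold. The tensor product $\otimes_\epsilon$ on morphisms of $\mathcal{D}$ is associative: $f\otimes_\epsilon(g\otimes_\epsilon h)=(f\otimes_\epsilon g)\otimes_\epsilon h$ for all $f,g,h\in Mor(\mathcal{D})$.
   Context: Planar graphs. A graph is a triple $(H,P,\sigma)$ with $H$ a finite set (half-edges), $P$ a partition of $H$ into nonempty blocks (vertices), $\sigma$ an involution of $H$ (its orbits are the edges), such that a vertex containing a two-element $\sigma$-orbit equals that orbit; such vertices and edges are called virtual, all other vertices real. A leg is a half-edge fixed by $\sigma$ (real leg) or lying in a virtual edge (virtual leg). An orientation $\mathrm{sgn}:H\to\{+,-\}$ takes different values on the two elements of each two-element orbit; $In(v),Out(v)$ (resp. $In(\Gamma),Out(\Gamma)$) are the sets of half-edges in $v$ (resp. of legs) of sign $+$, $-$. The graph is directed if all $In(v),Out(v)$ are nonempty. The source (target) of an edge is the vertex containing its $-$ ($+$) half-edge, if there is one; $e\to e'$ means there are edges $e=e_1,\dots,e_n=e'$, $n\ge 1$, with the target of $e_i$ equal to the source of $e_{i+1}$. A planar graph is a directed graph with a linear order $\prec$ on its edges such that for all distinct edges: $e_1\to e_2$ implies $e_1\prec e_2$; and if $e_1\to e_2$ and $e_1\prec e_3\prec e_2$ then $e_1\to e_3$ or $e_3\to e_2$. The sets $In(\cdot)$, $Out(\cdot)$ are ordered by $\prec$ applied to the edges containing their elements. A graph is unitary if it consists of exactly one virtual vertex; prime if it has exactly one vertex and is not unitary. $\Gamma_1\otimes\Gamma_2$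 is the disjoint union, with all edges of $\Gamma_1$ preceding those of $\Gamma_2$. If $Out(\Gamma_1)=\{o_1,\dots,o_n\}$ and $In(\Gamma_2)=\{i_1,\dots,i_n\}$ in increasing order, $\Gamma_2\circ\Gamma_1$ is obtained from the disjoint union by grafting $o_k$ to $i_k$ for each $k$: if both are real legs, join them into an edge $\bar e_k=\{o_k,i_k\}$; if exactly one is virtual, delete its virtual edge, the edge of the other being $\bar e_k$; if both are virtual, delete $o_k,i_k$ and let $\bar e_k=\{\sigma_1(o_k),\sigma_2(i_k)\}$ be a virtual edge (and a virtual vertex). The order of edges is $A_1,\bar e_1,B_1,\dots,A_n,\bar e_n,B_n$, where $A_k$ is the set of edges of $\Gamma_1$ strictly between the edges of $o_{k-1}$ and $o_k$ (before that of $o_1$ if $k=1$) and $B_k$ the set of edges of $\Gamma_2$ strictly between the edges of $i_k$ and $i_{k+1}$ (after that of $i_n$ if $k=n$), each with its own order. Tensor manifolds. $W(S)$ is the set of words (including the empty one) in $S$. A tensor scheme $\mathcal{D}$ consists of sets $Ob(\mathcal{D})$, $Mor(\mathcal{D})$ and maps $s,t:Mor(\mathcal{D})\to W(Ob(\mathcal{D}))$ whose values are nonempty words; morphisms of tensor schemes are pairs of maps $(\varphi_o,\varphi_m)$ compatible with $s,t$. A diagram in $\mathcal{D}$ is a planar graph $\Gamma$ with a $\sigma$-invariant map $\gamma_o$ from half-edges to $Ob(\mathcal{D})$ and a map $\gamma_m$ from real vertices to $Mor(\mathcal{D})$ such that $s(\gamma_m(v))$, $t(\gamma_m(v))$ are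 the words of values of $\gamma_o$ along $In(v)$, $Out(v)$; its domain and codomain are the words along $In(\Gamma)$, $Out(\Gamma)$. Diagrams are taken up to bijections of half-edges preserving all structure; tensor product and composition are those of planar graphs with inherited decorations; they form a strict monoidal category $F(\mathcal{D})$ with objects $W(Ob(\mathcal{D}))$ under concatenation, identities being tensor products of unitary diagrams. $T(\mathcal{D})$ is the tensor scheme with $Ob(T(\mathcal{D}))=W(Ob(\mathcal{D}))$ whose morphisms are bracketed diagrams $(w_1\cdots w_m;u_1\cdots u_n;\Gamma)$, $m,n\ge1$, with $w_i,u_j\in W(Ob(\mathcal{D}))$ and $\Gamma$ a diagram in $\mathcal{D}$ with domain the concatenation of the $w_i$ and codomain that of the $u_j$; source $w_1\cdots w_m$, target $u_1\cdots u_n$ (words in words). $T$ acts on morphisms by relabelling. $\eta_{\mathcal{D}}:\mathcal{D}\to T(\mathcal{D})$ sends $x$ to the one-letter word $(x)$ and $f:x_1\cdots x_m\to y_1\cdots y_n$ to $((x_1)\cdots(x_m);(y_1)\cdots(y_n);\Gamma_f)$, with $\Gamma_f$ the prime diagram with vertex decorated by $f$. $\mu_{\mathcal{D}}:TT(\mathcal{D})\to T(\mathcal{D})$ concatenates words of words and sends a bracketed diagram $\Delta$ in $T(\mathcal{D})$ to its value in $F(\mathcal{D})$ (the diagram in $\mathcal{D}$ obtained by tensoring and composing, as prescribed by $\Delta$, the diagrams decorating its vertices), each bracket being concatenated. A tensor manifold is an algebra $(\mathcal{D},\epsilon)$ of the monad $(T,\mu,\eta)$: a morphism of tensor schemes $\epsilon=(\epsilon_o,\epsilon_m):T(\mathcal{D})\to\mathcal{D}$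 with $\epsilon\circ T(\epsilon)=\epsilon\circ\mu_{\mathcal{D}}$ and $\epsilon\circ\eta_{\mathcal{D}}=Id$. Operation. For $f:x_1\cdots x_m\to y_1\cdots y_n$ and $g:u_1\cdots u_k\to v_1\cdots v_l$ in $\mathcal{D}$, $f\otimes_\epsilon g=\epsilon_m\big((x_1)\cdots(x_m)(u_1)\cdots(u_k);(y_1)\cdots(y_n)(v_1)\cdots(v_l);\Gamma_f\otimes\Gamma_g\big)$, with every bracket a one-letter word. *)

(* Defs.v *)
From mathcomp Require Import all_boot boolp.

Set Implicit Arguments.
Unset Strict Implicit.
Unset Printing Implicit Defensive.

(** * Graphs *)

(* [pos h] says that [h] has sign +.  The order on edges is stored as its
   pull-back [prec] to half-edges: [prec h h'] means that the edge containing
   [h] strictly precedes the edge containing [h'].  The axioms relating these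
   data are collected in [graph_axioms] and [planar] below. *)
Record graph := Graph {
  half : finType;
  vertices : {set {set half}};
  sigma : half -> half;
  pos : half -> bool;
  prec : rel half
}.

Arguments vertices : clear implicits.
Arguments sigma {g} h.
Arguments pos {g} h.
Arguments prec {g} h h'.

Definition edge (G : graph) (h : half G) : {set half G} := [set h; sigma h].

Definition virtual (G : graph) (h : half G) : bool :=
  (sigma h != h) && (edge h \in vertices G).

Definition virtual_vertices (G : graph) : {set {set half G}} :=
  [set edge h | h in [pred h : half G | virtual h]].

Definition real_vertices (G : graph) : {set {set half G}} :=
  vertices G :\: virtual_vertices G.

Definition leg (G : graph) (h : half G) : bool := (sigma h == h) || virtual h.

Definition vertex_in (G : graph) (v : {set half G}) := [set h in v | pos h].
Definition vertex_out (G : graph) (v : {set half G}) := [set h in v | ~~ pos h].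
Definition graph_in (G : graph) := [set h : half G | leg h & pos h].
Definition graph_out (G : graph) := [set h : half G | leg h & ~~ pos h].

Record graph_axioms (G : graph) : Prop := GraphAxioms {
  vertices_partition : partition (vertices G) [set: half G];
  sigma_involutive : involutive (@sigma G);
  vertex_edge : forall v (h : half G), v \in vertices G -> sigma h != h ->
    edge h \subset v -> v = edge h;
  sigma_pos : forall h : half G, sigma h != h -> pos (sigma h) = ~~ pos h
}.

Definition directed (G : graph) : Prop :=
  forall v, v \in vertices G -> vertex_in v != set0 /\ vertex_out v != set0.

Definition is_source (G : graph) (v : {set half G}) (h : half G) : bool :=
  (v \in vertices G) && [exists x in edge h, ~~ pos x && (x \in v)].

Definition is_target (G : graph) (v : {set half G}) (h : half G) : bool :=
  (v \in vertices G) && [exists x in edge h, pos x && (x \in v)].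

Definition step (G : graph) : rel (half G) :=
  fun h1 h2 => [exists v, is_target v h1 && is_source v h2].

(* On half-edges of distinct edges this is the relation e -> e'. *)
Definition reach (G : graph) : rel (half G) := connect (@step G).

Record planar (G : graph) : Prop := Planar {
  planar_graph : graph_axioms G;
  planar_directed : directed G;
  prec_sigmal : forall h1 h2 : half G, prec (sigma h1) h2 = prec h1 h2;
  prec_sigmar : forall h1 h2 : half G, prec h1 (sigma h2) = prec h1 h2;
  prec_irr : irreflexive (@prec G);
  prec_trans : transitive (@prec G);
  prec_total : forall h1 h2 : half G, edge h1 != edge h2 ->
    prec h1 h2 || prec h2 h1;
  reach_prec : forall h1 h2 : half G, edge h1 != edge h2 ->
    reach h1 h2 -> prec h1 h2;
  prec_between : forall h1 h2 h3 : half G, edge h1 != edge h2 ->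
    reach h1 h2 -> prec h1 h3 -> prec h3 h2 -> reach h1 h3 || reach h3 h2
}.

(* The elements of [A] in increasing order of their edges; only used for sets
   of half-edges of one sign, which meet each edge at most once. *)
Definition ordered (G : graph) (A : {set half G}) : seq (half G) :=
  sort (fun x y => ~~ prec y x) (enum A).

Definition ins (G : graph) := ordered (graph_in G).
Definition outs (G : graph) := ordered (graph_out G).

Definition empty_graph : graph :=
  @Graph void set0 id (fun=> true) (fun _ _ => false).

Definition unitary_graph : graph :=
  @Graph bool [set [set: bool]] negb id (fun _ _ => false).

(* The prime graph with m inputs and n outputs; by [reach_prec] the inputs have
   to precede the outputs. *)
Definition prime_graph (m n : nat) : graph :=
  @Graph ('I_m + 'I_n)%type [set [set: 'I_m + 'I_n]] id
    (fun h => if h is inl _ then true else false)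
    (fun h h' => match h, h' with
     | inl i, inl j => i < j
     | inl _, inr _ => true
     | inr _, inl _ => false
     | inr i, inr j => i < j
     end).

Definition gtensor (G1 G2 : graph) : graph :=
  @Graph (half G1 + half G2)%type
    ([set inl @: (v : {set half G1}) | v in vertices G1]
       :|: [set inr @: (v : {set half G2}) | v in vertices G2])
    (fun h => match h with inl x => inl (sigma x) | inr x => inr (sigma x) end)
    (fun h => match h with inl x => pos x | inr x => pos x end)
    (fun h h' => match h, h' with
     | inl x, inl y => prec x y
     | inl _, inr _ => true
     | inr _, inl _ => false
     | inr x, inr y => prec x y
     end).

(** ** Composition of graphs *)

(* The grafted pairs (o_k, i_k); [gcomp G2 G1] is G2 after G1. *)
Definition grafts (G2 G1 : graph) : seq (half G1 * half G2) :=
  zip (outs G1) (ins G2).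

(* If o is virtual and i is real, both halves o and [sigma o] are deleted; if
   o and i are both virtual, only o and i are. *)
Definition kept (G2 G1 : graph) (x : half G1 + half G2) : bool :=
  match x with
  | inl h => all (fun p => virtual p.1 ==>
               (h != p.1) && ((h == sigma p.1) ==> virtual p.2)) (grafts G2 G1)
  | inr h => all (fun p => virtual p.2 ==>
               (h != p.2) && ((h == sigma p.2) ==> virtual p.1)) (grafts G2 G1)
  end.

Definition comp_half (G2 G1 : graph) : finType :=
  {x : half G1 + half G2 | kept x}.

(* For a kept half-edge h on the edge of some o_k: if o_k, i_k are both real
   then h = o_k is joined to i_k = sigma i_k; if both are virtual then
   h = sigma o_k is joined to sigma i_k; otherwise h = o_k remains a real leg.
   Symmetrically for G2. *)
Definition comp_sigma (G2 G1 : graph) (x : half G1 + half G2) :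
    half G1 + half G2 :=
  match x with
  | inl h =>
      if ohead [seq p <- grafts G2 G1 | h \in edge p.1] is Some p then
        if virtual p.1 == virtual p.2 then inr (sigma p.2) else inl h
      else inl (sigma h)
  | inr h =>
      if ohead [seq p <- grafts G2 G1 | h \in edge p.2] is Some p then
        if virtual p.1 == virtual p.2 then inl (sigma p.1) else inr h
      else inr (sigma h)
  end.

(* The order A_1, e_1, B_1, ..., A_n, e_n, B_n: an edge h of G1 lies in A_k or
   is e_k for the least k with h <= o_k, an edge h' of G2 lies in B_k or is
   e_k for the largest k with i_k <= h'.  So h comes before or is equal to h'
   iff h <= o_k and i_k <= h' for some k, and they are equal iff they are the
   edges of o_k and i_k for some k. *)
Definition le_through (G2 G1 : graph) (h : half G1) (h' : half G2) : bool :=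
  has (fun p => ~~ prec p.1 h && ~~ prec h' p.2) (grafts G2 G1).

Definition same_through (G2 G1 : graph) (h : half G1) (h' : half G2) : bool :=
  has (fun p => (h \in edge p.1) && (h' \in edge p.2)) (grafts G2 G1).

Definition comp_prec (G2 G1 : graph) : rel (half G1 + half G2) :=
  fun x y => match x, y with
  | inl h, inl h' => prec h h'
  | inl h, inr h' => le_through h h' && ~~ same_through h h'
  | inr h', inl h => ~~ le_through h h'
  | inr h, inr h' => prec h h'
  end.

Definition restrict (G2 G1 : graph) (A : {set half G1 + half G2}) :
    {set comp_half G2 G1} := [set x | val x \in A].

(* Every virtual vertex of G1 or G2 contains some o_k or i_k, so the virtual
   vertices of the composite are those made from two virtual ones. *)
Definition gcomp (G2 G1 : graph) : graph :=
  @Graph (comp_half G2 G1)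
    ([set restrict (inl @: (v : {set half G1})) | v in real_vertices G1]
       :|: [set restrict (inr @: (v : {set half G2})) | v in real_vertices G2]
       :|: [set restrict [set inl (sigma p.1); inr (sigma p.2)]
             | p in [pred p | (p \in grafts G2 G1)
                                && (virtual p.1 && virtual p.2)]])
    (fun x => insubd x (comp_sigma (val x)))
    (fun x => match val x with inl h => pos h | inr h => pos h end)
    (fun x y => comp_prec (val x) (val y)).

(** * Tensor schemes and diagrams *)

Record tensor_scheme := TensorScheme {
  Ob : Type;
  Mor : Type;
  src : Mor -> seq Ob;
  tgt : Mor -> seq Ob;
  src_neq0 : forall f, src f <> [::];
  tgt_neq0 : forall f, tgt f <> [::]
}.

Arguments src {t} f.
Arguments tgt {t} f.

Record scheme_morphism (D E : tensor_scheme) := SchemeMorphism {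
  fo : Ob D -> Ob E;
  fm : Mor D -> Mor E;
  src_fm : forall f, src (fm f) = [seq fo x | x <- src f];
  tgt_fm : forall f, tgt (fm f) = [seq fo x | x <- tgt f]
}.

(* A graph with decorations; [dec v] is only meaningful for real vertices [v],
   where [diagram_axioms] requires it to be some morphism. *)
Record prediagram (D : tensor_scheme) := Prediagram {
  dgraph :> graph;
  col : half dgraph -> Ob D;
  dec : {set half dgraph} -> option (Mor D)
}.

Arguments Prediagram {D} dgraph col dec.
Arguments col {D} p h.
Arguments dec {D} p v.

Definition dom (D : tensor_scheme) (G : prediagram D) : seq (Ob D) :=
  [seq col G h | h <- ins G].
Definition cod (D : tensor_scheme) (G : prediagram D) : seq (Ob D) :=
  [seq col G h | h <- outs G].

Record diagram_axioms (D : tensor_scheme) (G : prediagram D) : Prop :=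
  DiagramAxioms {
    diagram_planar : planar G;
    col_sigma : forall h : half G, col G (sigma h) = col G h;
    dec_real : forall v, v \in real_vertices G -> exists f,
      [/\ dec G v = Some f,
          src f = [seq col G h | h <- ordered (vertex_in v)] &
          tgt f = [seq col G h | h <- ordered (vertex_out v)]]
  }.

Definition iso (D : tensor_scheme) (G G' : prediagram D) : Prop :=
  exists f : half G -> half G',
    bijective f
    /\ [set f @: (v : {set half G}) | v in vertices G] = vertices G'
    /\ {morph f : h / sigma h}
    /\ (forall h, pos (f h) = pos h)
    /\ (forall h h', prec (f h) (f h') = prec h h')
    /\ (forall h, col G' (f h) = col G h)
    /\ (forall v, v \in real_vertices G -> dec G' (f @: v) = dec G v).

Definition empty_diagram (D : tensor_scheme) : prediagram D :=
  @Prediagram D empty_graph (fun h => match h with end) (fun=> None).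

Definition unitary (D : tensor_scheme) (x : Ob D) : prediagram D :=
  @Prediagram D unitary_graph (fun=> x) (fun=> None).

Definition prime_diagram (D : tensor_scheme) (f : Mor D) : prediagram D :=
  @Prediagram D (prime_graph (size (src f)) (size (tgt f)))
    (fun h => match h with
     | inl i => tnth (in_tuple (src f)) i
     | inr j => tnth (in_tuple (tgt f)) j
     end)
    (fun=> Some f).

Definition tensor (D : tensor_scheme) (G1 G2 : prediagram D) : prediagram D :=
  @Prediagram D (gtensor G1 G2)
    (fun h => match h with inl x => col G1 x | inr x => col G2 x end)
    (fun v => let v1 := inl @^-1: v in let v2 := inr @^-1: v in
       if v1 != set0 then dec G1 v1 else dec G2 v2).

Definition compose (D : tensor_scheme) (G2 G1 : prediagram D) : prediagram D :=
  @Prediagram D (gcomp G2 G1)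
    (fun x => match val x with inl h => col G1 h | inr h => col G2 h end)
    (fun v => let w := val @: (v : {set comp_half G2 G1}) in
       let v1 := inl @^-1: w in let v2 := inr @^-1: w in
       if v1 != set0 then dec G1 v1 else dec G2 v2).

Definition idw (D : tensor_scheme) (w : seq (Ob D)) : prediagram D :=
  foldr (fun x G => tensor (unitary x) G) (empty_diagram D) w.

Definition relabel (D E : tensor_scheme) (phi : scheme_morphism D E)
    (G : prediagram D) : prediagram E :=
  @Prediagram E (dgraph G) (fun h => fo phi (col G h))
    (fun v => omap (fm phi) (dec G v)).

(** ** Isomorphism classes *)

Lemma iso_refl (D : tensor_scheme) (G : prediagram D) : iso G G.
Proof.
exists id; split; first by exists id.
by split; [rewrite -[RHS]imset_id; apply: eq_imset => v; rewrite /= imset_id|];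
  do 5?split => //; move=> v _; rewrite imset_id.
Qed.

Lemma virtual_iso (G G' : graph) (f : half G -> half G') :
  bijective f ->
  [set f @: (v : {set half G}) | v in vertices G] = vertices G' ->
  {morph f : h / sigma h} -> forall h, virtual (f h) = virtual h.
Proof.
move=> fb fV fs h; have fi := bij_inj fb.
rewrite /virtual -fs (inj_eq fi) -fV; congr andb.
have -> : edge (f h) = f @: edge h by rewrite /edge imsetU1 imset_set1 fs.
exact/mem_imset/imset_inj.
Qed.

Lemma real_vertices_iso (G G' : graph) (f : half G -> half G') :
  bijective f ->
  [set f @: (v : {set half G}) | v in vertices G] = vertices G' ->
  {morph f : h / sigma h} ->
  forall v : {set half G}, (f @: v \in real_vertices G') = (v \in real_vertices G).
Proof.
move=> fb fV fs v; have fi := bij_inj fb; case: (fb) => g fK gK.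
rewrite !inE -fV mem_imset; last exact: imset_inj.
congr (~~ _ && _); apply/imsetP/imsetP => -[h]; rewrite inE => hv E.
  exists (g h); first by rewrite inE -(virtual_iso fb fV fs) gK.
  apply: (imset_inj fi); rewrite E /edge imsetU1 imset_set1 fs gK.
  by rewrite -[h in sigma h]gK.
exists (f h); first by rewrite inE (virtual_iso fb fV fs).
by rewrite E /edge imsetU1 imset_set1 fs.
Qed.

Lemma iso_sym (D : tensor_scheme) (G G' : prediagram D) : iso G G' -> iso G' G.
Proof.
case=> f [fb [fV [fs [fp [fr [fc fd]]]]]]; case: (fb) => g fK gK.
have gfv (v : {set half G}) : g @: (f @: v) = v.
  by rewrite -imset_comp (eq_imset _ fK) imset_id.
have fgv (v : {set half G'}) : f @: (g @: v) = v.
  by rewrite -imset_comp (eq_imset _ gK) imset_id.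
exists g; split; first by exists f.
split; first by rewrite -fV -imset_comp (eq_imset _ gfv) imset_id.
split; first by move=> h; apply: (can_inj fK); rewrite fs !gK.
split; first by move=> h; rewrite -fp gK.
split; first by move=> h h'; rewrite -fr !gK.
split; first by move=> h; rewrite -fc gK.
by move=> v vr; rewrite -fd ?fgv // -(real_vertices_iso fb fV fs) fgv.
Qed.

Lemma iso_trans (D : tensor_scheme) (G1 G2 G3 : prediagram D) :
  iso G1 G2 -> iso G2 G3 -> iso G1 G3.
Proof.
case=> f [fb [fV [fs [fp [fr [fc fd]]]]]].
case=> g [gb [gV [gs [gp [gr [gc gd]]]]]].
exists (g \o f); split; first exact: bij_comp.
split.
  rewrite -gV -fV -imset_comp; apply: eq_imset => v /=.
  by rewrite imset_comp.
split; first by move=> h; rewrite /= fs gs.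
split; first by move=> h; rewrite /= gp fp.
split; first by move=> h h'; rewrite /= gr fr.
split; first by move=> h; rewrite /= gc fc.
move=> v vr; rewrite imset_comp gd ?fd //.
by rewrite (real_vertices_iso fb fV fs).
Qed.

Lemma iso_class (D : tensor_scheme) (G G' : prediagram D) :
  iso G G' -> iso G = iso G'.
Proof.
move=> GG'; apply/funext => K; apply/propext; split; last exact: iso_trans.
exact/iso_trans/iso_sym.
Qed.

Lemma relabel_iso (D E : tensor_scheme) (phi : scheme_morphism D E)
    (G G' : prediagram D) :
  iso G G' -> iso (relabel phi G) (relabel phi G').
Proof.
case=> f [fb [fV [fs [fp [fr [fc fd]]]]]]; exists f; do 5!split => //.
split=> [h|v vr] /=; first by rewrite fc.
by rewrite fd.
Qed.

Lemma relabel_axioms (D E : tensor_scheme) (phi : scheme_morphism D E)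
    (G : prediagram D) :
  diagram_axioms G -> diagram_axioms (relabel phi G).
Proof.
case=> Gp Gs Gd; split=> //= [h|v /Gd [f [fE fs ft]]]; first by rewrite Gs.
exists (fm phi f); split; first by rewrite fE.
  by rewrite src_fm fs -map_comp.
by rewrite tgt_fm ft -map_comp.
Qed.

Lemma dom_relabel (D E : tensor_scheme) (phi : scheme_morphism D E)
    (G : prediagram D) : dom (relabel phi G) = map (fo phi) (dom G).
Proof. by rewrite /dom -map_comp. Qed.

Lemma cod_relabel (D E : tensor_scheme) (phi : scheme_morphism D E)
    (G : prediagram D) : cod (relabel phi G) = map (fo phi) (cod G).
Proof. by rewrite /cod -map_comp. Qed.

(** ** Ordered sequences of half-edges *)

Section Ordered.

Variables (G : graph) (A : {set half G}).
Hypotheses (Gt : transitive (@prec G)) (Gi : irreflexive (@prec G)).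
Hypothesis AG : {in A &, forall x y, x != y -> prec x y || prec y x}.

Lemma mem_ordered : ordered A =i A.
Proof. by move=> x; rewrite mem_sort mem_enum. Qed.

Lemma ordered_sorted : sorted prec (ordered A).
Proof.
have : sorted (fun x y => ~~ prec y x) (ordered A).
  apply: (@sort_sorted_in _ (mem A)); last first.
    by apply/allP => x; rewrite mem_enum.
  move=> x y _ _; apply/orP; case xy: (prec x y); [left|by right].
  by apply/negP => /(Gt xy); rewrite Gi.
have : uniq (ordered A) by rewrite sort_uniq enum_uniq.
have : {subset ordered A <= A} by move=> x; rewrite mem_ordered.
case: (ordered A) => //= x s; elim: s x => //= y s IH x sA.
move=> /andP[xs us] /andP[xy ys]; apply/andP; split; last first.
  by apply: IH => // z zs; apply: sA; rewrite inE zs orbT.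
have := AG (sA x (mem_head _ _)) (sA y _); rewrite (negPf xy) orbF; apply.
  by rewrite !inE eqxx orbT.
by apply: contraNneq xs => ->; rewrite mem_head.
Qed.

Lemma ordered_unique s : sorted prec s -> s =i A -> ordered A = s.
Proof.
move=> ss sA; apply: (irr_sorted_eq Gt Gi) => //; first exact: ordered_sorted.
by move=> x; rewrite mem_ordered sA.
Qed.

End Ordered.

Lemma edge_sigma (G : graph) (h : half G) :
  involutive (@sigma G) -> edge (sigma h) = edge h.
Proof. by move=> sK; rewrite /edge sK setUC. Qed.

Lemma mem_edge (G : graph) (h x : half G) :
  x \in edge h -> x = h \/ x = sigma h.
Proof. by rewrite !inE => /orP[]/eqP; [left|right]. Qed.

Lemma same_sign_total (G : graph) (A : {set half G}) (b : bool) :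
  planar G -> (forall h, h \in A -> pos h = b) ->
  {in A &, forall x y, x != y -> prec x y || prec y x}.
Proof.
move=> Gp Ab x y xA yA xy; apply: (prec_total Gp).
apply: contraNneq xy => xy.
have : x \in edge y by rewrite -xy !inE eqxx.
case/mem_edge=> [-> //|xE].
case: (eqVneq (sigma y) y) => [E|N]; first by rewrite xE E.
have := sigma_pos (planar_graph Gp) N; rewrite -xE (Ab _ xA) (Ab _ yA).
by case: (b).
Qed.

(** ** Prime diagrams *)

Lemma sorted_map_ord (n : nat) (T : Type) (e : rel T) (f : 'I_n -> T) :
  (forall i j : 'I_n, i < j -> e (f i) (f j)) -> sorted e (map f (enum 'I_n)).
Proof.
move=> fe; apply: homo_sorted (fun i j ij => fe i j ij) _ _.
have /= := iota_ltn_sorted 0 n; rewrite -val_enum_ord sorted_map.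
exact: sub_sorted.
Qed.

Section Prime.

Variables (m n : nat).
Hypotheses (m_gt0 : 0 < m) (n_gt0 : 0 < n).
Let P := prime_graph m n.

Lemma prime_edge (h : half P) : edge h = [set h].
Proof. by rewrite /edge /= setUid. Qed.

Lemma prime_virtual (h : half P) : virtual h = false.
Proof. by rewrite /virtual eqxx. Qed.

Lemma prime_step (x y : half P) : step x y = pos x && ~~ pos y.
Proof.
apply/existsP/andP => [[v]|[px py]].
  case/andP=> /andP[_ /existsP[a]] + /andP[_ /existsP[b]].
  rewrite !prime_edge !inE => /andP[/eqP-> /andP[px _]].
  by case/andP=> /eqP-> /andP[py _].
exists setT; rewrite /is_target /is_source !set11 !andTb.
by apply/andP; split; apply/existsP; [exists x|exists y];
  rewrite prime_edge set11 ?px ?py /= inE.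
Qed.

Lemma prime_reach (x y : half P) : x != y -> reach x y = pos x && ~~ pos y.
Proof.
move=> xy; apply/idP/idP; last by rewrite -prime_step => /connect1.
case/connectP=> -[|z p]; first by move=> _ /= E; rewrite E eqxx in xy.
case/andP; rewrite prime_step => /andP[-> pz]; case: p => [_ /= -> //|t p].
by case/andP; rewrite prime_step (negPf pz).
Qed.

Lemma prime_planar : planar P.
Proof.
have [i0 j0] : 'I_m * 'I_n by split; [exists 0|exists 0].
split=> //.
- split=> //; last by move=> h; rewrite eqxx.
    apply/and3P; split; first by rewrite /cover big_set1.
      exact: trivIset1.
    rewrite inE eq_sym -subset0; apply/subsetPn.
    by exists (inl i0); rewrite inE.
  by move=> v h _; rewrite eqxx.
- move=> v; rewrite inE => /eqP->; split; apply/set0Pn.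
    by exists (inl i0); rewrite !inE.
  by exists (inr j0); rewrite !inE.
- by case=> i /=; rewrite ltnn.
- by case=> i [j|j] [k|k] //=; apply: ltn_trans.
- move=> h1 h2; rewrite !prime_edge => N.
  have {N} : h1 != h2 by apply: contraNneq N => ->.
  by case: h1 h2 => i [j|j] //= ij; rewrite -neq_ltn; apply: contraNneq ij;
    move=> /val_inj->.
- move=> h1 h2; rewrite !prime_edge => N.
  have {}N : h1 != h2 by apply: contraNneq N => ->.
  by rewrite prime_reach //; case: h1 h2 N => i [j|j].
move=> h1 h2 h3; rewrite !prime_edge => N.
have {}N : h1 != h2 by apply: contraNneq N => ->.
rewrite prime_reach //; case: h1 h2 N => i [j|j] //= _ _.
by case: h3 => k _ _; apply/orP; [right|left]; rewrite prime_reach.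
Qed.

Lemma prime_ordered_pos (A : {set half P}) :
  (forall h, (h \in A) = pos h) -> ordered A = [seq inl i | i <- enum 'I_m].
Proof.
move=> AE; have Gp := prime_planar.
apply: ordered_unique; [exact: prec_trans|exact: prec_irr| | |].
- by apply: (@same_sign_total _ _ true) => // h; rewrite AE.
- exact: sorted_map_ord.
move=> [i|j]; rewrite AE /=; last by apply/mapP => -[].
by apply/mapP; exists i => //; rewrite mem_enum.
Qed.

Lemma prime_ordered_neg (A : {set half P}) :
  (forall h, (h \in A) = ~~ pos h) -> ordered A = [seq inr i | i <- enum 'I_n].
Proof.
move=> AE; have Gp := prime_planar.
apply: ordered_unique; [exact: prec_trans|exact: prec_irr| | |].
- by apply: (@same_sign_total _ _ false) => // h; rewrite AE => /negbTE.
- exact: sorted_map_ord.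
move=> [i|j]; rewrite AE /=; first by apply/mapP => -[].
by apply/mapP; exists j => //; rewrite mem_enum.
Qed.

End Prime.

Lemma size_src_gt0 (D : tensor_scheme) (f : Mor D) : 0 < size (src f).
Proof. by case: (src f) (@src_neq0 _ f). Qed.

Lemma size_tgt_gt0 (D : tensor_scheme) (f : Mor D) : 0 < size (tgt f).
Proof. by case: (tgt f) (@tgt_neq0 _ f). Qed.

Lemma map_tnth_in_tuple (T : Type) (s : seq T) :
  [seq tnth (in_tuple s) i | i <- enum 'I_(size s)] = s.
Proof. exact: (map_tnth_enum (in_tuple s)). Qed.

Lemma prime_axioms (D : tensor_scheme) (f : Mor D) :
  diagram_axioms (prime_diagram f).
Proof.
have m0 := size_src_gt0 f; have n0 := size_tgt_gt0 f.
split=> //; first exact: prime_planar.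
move=> v; rewrite !inE => /andP[_ /eqP->]; exists f; split=> //.
  rewrite prime_ordered_pos // => [|h]; last by rewrite !inE.
  by rewrite -map_comp -[LHS]map_tnth_in_tuple.
rewrite prime_ordered_neg // => [|h]; last by rewrite !inE.
by rewrite -map_comp -[LHS]map_tnth_in_tuple.
Qed.

Lemma dom_prime (D : tensor_scheme) (f : Mor D) :
  dom (prime_diagram f) = src f.
Proof.
rewrite /dom /ins prime_ordered_pos ?size_src_gt0 ?size_tgt_gt0 // => [|h].
  by rewrite -map_comp -[RHS]map_tnth_in_tuple.
by rewrite !inE /leg eqxx.
Qed.

Lemma cod_prime (D : tensor_scheme) (f : Mor D) :
  cod (prime_diagram f) = tgt f.
Proof.
rewrite /cod /outs prime_ordered_neg ?size_src_gt0 ?size_tgt_gt0 // => [|h].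
  by rewrite -map_comp -[RHS]map_tnth_in_tuple.
by rewrite !inE /leg eqxx.
Qed.

(** ** Tensor products of diagrams *)

Section Tensor.

Variables G1 G2 : graph.
Let T := gtensor G1 G2.
Let inl' : half G1 -> half T := inl.
Let inr' : half G2 -> half T := inr.

Let inl'_inj : injective inl'. Proof. by move=> x y []. Qed.
Let inr'_inj : injective inr'. Proof. by move=> x y []. Qed.

Lemma tensor_edgel x : edge (inl' x) = inl' @: edge x.
Proof. by rewrite /edge imsetU1 imset_set1. Qed.

Lemma tensor_edger x : edge (inr' x) = inr' @: edge x.
Proof. by rewrite /edge imsetU1 imset_set1. Qed.

Lemma tensor_verticesP (v : {set half T}) :
  reflect ((exists2 w, w \in vertices G1 & v = inl' @: w) \/
           (exists2 w, w \in vertices G2 & v = inr' @: w))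
          (v \in vertices T).
Proof. by rewrite inE; apply: (iffP orP) => -[] /imsetP; [left|right|left|right]. Qed.

Lemma tensor_verticesl (v : {set half G1}) x :
  x \in v -> (inl' @: v \in vertices T) = (v \in vertices G1).
Proof.
move=> xv; apply/tensor_verticesP/idP => [|vV]; last by left; exists v.
case=> -[w wV E]; first by rewrite (imset_inj inl'_inj E).
have : inl' x \in inr' @: w by rewrite -E imset_f.
by case/imsetP.
Qed.

Lemma tensor_verticesr (v : {set half G2}) x :
  x \in v -> (inr' @: v \in vertices T) = (v \in vertices G2).
Proof.
move=> xv; apply/tensor_verticesP/idP => [|vV]; last by right; exists v.
case=> -[w wV E]; last by rewrite (imset_inj inr'_inj E).
have : inr' x \in inl' @: w by rewrite -E imset_f.
by case/imsetP.
Qed.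

Lemma tensor_virtuall x : virtual (inl' x) = virtual x.
Proof.
by rewrite /virtual tensor_edgel (@tensor_verticesl _ x) // !inE eqxx.
Qed.

Lemma tensor_virtualr x : virtual (inr' x) = virtual x.
Proof.
by rewrite /virtual tensor_edger (@tensor_verticesr _ x) // !inE eqxx.
Qed.

Lemma tensor_realP (v : {set half T}) :
  reflect ((exists2 w, w \in real_vertices G1 & v = inl' @: w) \/
           (exists2 w, w \in real_vertices G2 & v = inr' @: w))
          (v \in real_vertices T).
Proof.
apply: (iffP setDP) => [[/tensor_verticesP[]]|].
- case=> w wV -> N; left; exists w => //; apply/setDP; split=> //.
  apply: contra N => /imsetP[h hv ->]; apply/imsetP; exists (inl' h).
    by rewrite inE tensor_virtuall.
  by rewrite tensor_edgel.
- case=> w wV -> N; right; exists w => //; apply/setDP; split=> //.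
  apply: contra N => /imsetP[h hv ->]; apply/imsetP; exists (inr' h).
    by rewrite inE tensor_virtualr.
  by rewrite tensor_edger.
case=> -[w /setDP[wV N] E].
  split; first by apply/tensor_verticesP; left; exists w.
  apply: contra N => /imsetP[[h|h]]; rewrite inE ?tensor_virtuall => hv Eh.
    apply/imsetP; exists h => //; apply: (imset_inj inl'_inj).
    by rewrite -E Eh tensor_edgel.
  have : inr' h \in edge (inr' h) by rewrite !inE eqxx.
  by rewrite -Eh E => /imsetP[].
split; first by apply/tensor_verticesP; right; exists w.
apply: contra N => /imsetP[[h|h]]; rewrite inE ?tensor_virtualr => hv Eh.
  have : inl' h \in edge (inl' h) by rewrite !inE eqxx.
  by rewrite -Eh E => /imsetP[].
apply/imsetP; exists h => //; apply: (imset_inj inr'_inj).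
by rewrite -E Eh tensor_edger.
Qed.

Lemma tensor_targetl (v : {set half G1}) x :
  is_target v x -> is_target (inl' @: v) (inl' x).
Proof.
case/andP=> vV /existsP[y /andP[yx /andP[py yv]]].
rewrite /is_target (tensor_verticesl yv) vV; apply/existsP; exists (inl' y).
by rewrite tensor_edgel !mem_imset // yx yv /= ?py.
Qed.

Lemma tensor_sourcel (v : {set half G1}) x :
  is_source v x -> is_source (inl' @: v) (inl' x).
Proof.
case/andP=> vV /existsP[y /andP[yx /andP[py yv]]].
rewrite /is_source (tensor_verticesl yv) vV; apply/existsP; exists (inl' y).
by rewrite tensor_edgel !mem_imset // yx yv /= ?py.
Qed.

Lemma tensor_targetr (v : {set half G2}) x :
  is_target v x -> is_target (inr' @: v) (inr' x).
Proof.
case/andP=> vV /existsP[y /andP[yx /andP[py yv]]].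
rewrite /is_target (tensor_verticesr yv) vV; apply/existsP; exists (inr' y).
by rewrite tensor_edger !mem_imset // yx yv /= ?py.
Qed.

Lemma tensor_sourcer (v : {set half G2}) x :
  is_source v x -> is_source (inr' @: v) (inr' x).
Proof.
case/andP=> vV /existsP[y /andP[yx /andP[py yv]]].
rewrite /is_source (tensor_verticesr yv) vV; apply/existsP; exists (inr' y).
by rewrite tensor_edger !mem_imset // yx yv /= ?py.
Qed.

Lemma tensor_target_inv v (h : half T) : is_target v h ->
  match h with
  | inl x => exists2 w, is_target w x & v = inl' @: w
  | inr x => exists2 w, is_target w x & v = inr' @: w
  end.
Proof.
case: h => x /andP[/tensor_verticesP vV /existsP[y]].
  rewrite tensor_edgel => /andP[/imsetP[z zx ->] /andP[pz]].
  case: vV => -[w wV ->]; last by case/imsetP.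
  rewrite mem_imset // => zw; exists w => //; rewrite /is_target wV.
  by apply/existsP; exists z; rewrite zx zw andbT.
rewrite tensor_edger => /andP[/imsetP[z zx ->] /andP[pz]].
case: vV => -[w wV ->]; first by case/imsetP.
rewrite mem_imset // => zw; exists w => //; rewrite /is_target wV.
by apply/existsP; exists z; rewrite zx zw andbT.
Qed.

Lemma tensor_source_inv v (h : half T) : is_source v h ->
  match h with
  | inl x => exists2 w, is_source w x & v = inl' @: w
  | inr x => exists2 w, is_source w x & v = inr' @: w
  end.
Proof.
case: h => x /andP[/tensor_verticesP vV /existsP[y]].
  rewrite tensor_edgel => /andP[/imsetP[z zx ->] /andP[pz]].
  case: vV => -[w wV ->]; last by case/imsetP.
  rewrite mem_imset // => zw; exists w => //; rewrite /is_source wV.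
  by apply/existsP; exists z; rewrite zx zw andbT.
rewrite tensor_edger => /andP[/imsetP[z zx ->] /andP[pz]].
case: vV => -[w wV ->]; first by case/imsetP.
rewrite mem_imset // => zw; exists w => //; rewrite /is_source wV.
by apply/existsP; exists z; rewrite zx zw andbT.
Qed.

Lemma tensor_step (h1 h2 : half T) :
  step h1 h2 = match h1, h2 with
               | inl x, inl y => step x y
               | inr x, inr y => step x y
               | _, _ => false
               end.
Proof.
apply/idP/idP => [/existsP[v /andP[/tensor_target_inv tv /tensor_source_inv]]|].
  case: h1 h2 tv => x [y|y] [w wx ->] [w' wy].
  - move/(imset_inj inl'_inj) => E; apply/existsP; exists w.
    by rewrite wx E wy.
  - move=> E; case/andP: wx => _ /existsP[z /and3P[_ _]].
    by move=> /(imset_f inl'); rewrite E => /imsetP[].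
  - move=> E; case/andP: wx => _ /existsP[z /and3P[_ _]].
    by move=> /(imset_f inr'); rewrite E => /imsetP[].
  move/(imset_inj inr'_inj) => E; apply/existsP; exists w.
  by rewrite wx E wy.
case: h1 h2 => x [y|y] // /existsP[w /andP[wx wy]]; apply/existsP.
  by exists (inl' @: w); rewrite tensor_targetl ?tensor_sourcel.
by exists (inr' @: w); rewrite tensor_targetr ?tensor_sourcer.
Qed.

Lemma tensor_reach (h1 h2 : half T) :
  reach h1 h2 = match h1, h2 with
                | inl x, inl y => reach x y
                | inr x, inr y => reach x y
                | _, _ => false
                end.
Proof.
apply/idP/idP.
  case/connectP=> p; elim: p h1 => [|z p IH] h1.
    by move=> _ ->; case: h1 => x; apply: connect0.
  case/andP; rewrite tensor_step => h1z zp /(IH _ zp) {IH zp}.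
  case: h1 z h2 h1z => x [z|z] [y|y] // /connect1; exact: connect_trans.
case: h1 h2 => x [y|y] // /connectP[p]; elim: p x => [|z p IH] x.
- by move=> _ ->; apply: connect0.
- case/andP=> xz zp /(IH _ zp); apply: connect_trans; apply: connect1.
  by rewrite tensor_step.
- by move=> _ ->; apply: connect0.
case/andP=> xz zp /(IH _ zp); apply: connect_trans; apply: connect1.
by rewrite tensor_step.
Qed.

Lemma tensor_inlr_disjoint (v : {set half G1}) (w : {set half G2}) :
  [disjoint inl' @: v & inr' @: w].
Proof.
by apply/pred0Pn => -[x /andP[/imsetP[y _ ->] /imsetP[]]].
Qed.

Lemma tensor_graph_axioms :
  graph_axioms G1 -> graph_axioms G2 -> graph_axioms T.
Proof.
case=> P1 K1 E1 S1 [P2 K2 E2 S2]; split.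
- case/and3P: P1 => /eqP C1 /trivIsetP D1 N1.
  case/and3P: P2 => /eqP C2 /trivIsetP D2 N2.
  apply/and3P; split.
  + apply/eqP/setP => -[x|x]; rewrite inE; apply/bigcupP.
      have : x \in cover (vertices G1) by rewrite C1 inE.
      case/bigcupP=> v vV xv; exists (inl' @: v); last exact: imset_f.
      by rewrite (tensor_verticesl xv).
    have : x \in cover (vertices G2) by rewrite C2 inE.
    case/bigcupP=> v vV xv; exists (inr' @: v); last exact: imset_f.
    by rewrite (tensor_verticesr xv).
  + apply/trivIsetP => A B /tensor_verticesP hA /tensor_verticesP hB.
    case: hA hB => -[v vV ->] [] [w wV ->] N.
    * rewrite imset_disjoint //.
      by apply: D1 => //; apply: contraNneq N => ->.
    * exact: tensor_inlr_disjoint.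
    * by rewrite disjoint_sym tensor_inlr_disjoint.
    rewrite imset_disjoint //.
    by apply: D2 => //; apply: contraNneq N => ->.
  apply/tensor_verticesP => -[] [w wV /esym/eqP]; rewrite imset_eq0 => /eqP E.
    by rewrite -E wV in N1.
  by rewrite -E wV in N2.
- by case=> x /=; rewrite ?K1 ?K2.
- move=> v [x|x] /tensor_verticesP[] [w wV ->] sx.
  + rewrite tensor_edgel => sub; rewrite [in LHS](E1 w x) //.
    by apply/subsetP => y ye; rewrite -(mem_imset _ _ inl'_inj)
      (subsetP sub) ?imset_f.
  + move/subsetP/(_ (inl' x)); rewrite !inE eqxx => /(_ isT).
    by case/imsetP.
  + move/subsetP/(_ (inr' x)); rewrite !inE eqxx => /(_ isT).
    by case/imsetP.
  rewrite tensor_edger => sub; rewrite [in LHS](E2 w x) //.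
  by apply/subsetP => y ye; rewrite -(mem_imset _ _ inr'_inj)
    (subsetP sub) ?imset_f.
case=> x /= sx; [apply: S1|apply: S2];
  by apply: contraNneq sx => ->.
Qed.

Lemma tensor_vertex_inl (v : {set half G1}) :
  vertex_in (inl' @: v) = inl' @: vertex_in v.
Proof.
apply/setP => -[x|x]; rewrite !inE.
  by rewrite !mem_imset // inE.
by apply/andP/imsetP => [[/imsetP[]]|[]].
Qed.

Lemma tensor_vertex_outl (v : {set half G1}) :
  vertex_out (inl' @: v) = inl' @: vertex_out v.
Proof.
apply/setP => -[x|x]; rewrite !inE.
  by rewrite !mem_imset // inE.
by apply/andP/imsetP => [[/imsetP[]]|[]].
Qed.

Lemma tensor_vertex_inr (v : {set half G2}) :
  vertex_in (inr' @: v) = inr' @: vertex_in v.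
Proof.
apply/setP => -[x|x]; rewrite !inE; last by rewrite !mem_imset // inE.
by apply/andP/imsetP => [[/imsetP[]]|[]].
Qed.

Lemma tensor_vertex_outr (v : {set half G2}) :
  vertex_out (inr' @: v) = inr' @: vertex_out v.
Proof.
apply/setP => -[x|x]; rewrite !inE; last by rewrite !mem_imset // inE.
by apply/andP/imsetP => [[/imsetP[]]|[]].
Qed.

Lemma tensor_edge_neql x y :
  (edge (inl' x) != edge (inl' y)) = (edge x != edge y).
Proof. by rewrite !tensor_edgel (inj_eq (imset_inj inl'_inj)). Qed.

Lemma tensor_edge_neqr x y :
  (edge (inr' x) != edge (inr' y)) = (edge x != edge y).
Proof. by rewrite !tensor_edger (inj_eq (imset_inj inr'_inj)). Qed.

Lemma tensor_planar : planar G1 -> planar G2 -> planar T.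
Proof.
move=> [A1 D1 sl1 sr1 i1 t1 o1 r1 b1] [A2 D2 sl2 sr2 i2 t2 o2 r2 b2]; split.
- exact: tensor_graph_axioms.
- move=> v /tensor_verticesP[] [w wV ->].
    by rewrite tensor_vertex_inl tensor_vertex_outl !imset_eq0; apply: D1.
  by rewrite tensor_vertex_inr tensor_vertex_outr !imset_eq0; apply: D2.
- by case=> x [y|y] //=.
- by case=> x [y|y] //=.
- by case=> x /=.
- by case=> x [y|y] [z|z] //=; [apply: t1|apply: t2].
- case=> x [y|y] //=.
    by rewrite (tensor_edge_neql x y); apply: o1.
  by rewrite (tensor_edge_neqr x y); apply: o2.
- case=> x [y|y]; rewrite tensor_reach //=.
    by rewrite (tensor_edge_neql x y); apply: r1.
  by rewrite (tensor_edge_neqr x y); apply: r2.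
case=> x [y|y] z; rewrite !tensor_reach //.
  rewrite (tensor_edge_neql x y); case: z => z //=; exact: b1.
by rewrite (tensor_edge_neqr x y); case: z => z //=; exact: b2.
Qed.

Hypotheses (G1p : planar G1) (G2p : planar G2).

Lemma tensor_ordered (b : bool) (A1 : {set half G1}) (A2 : {set half G2})
    (A : {set half T}) :
  (forall h, h \in A1 -> pos h = b) -> (forall h, h \in A2 -> pos h = b) ->
  A = inl' @: A1 :|: inr' @: A2 ->
  ordered A = map inl' (ordered A1) ++ map inr' (ordered A2).
Proof.
move=> b1 b2 AE; have Tp := tensor_planar G1p G2p.
have so1 : sorted prec (ordered A1).
  by apply: ordered_sorted;
    [exact: prec_trans|exact: prec_irr|exact: (@same_sign_total _ _ b)].
have so2 : sorted prec (ordered A2).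
  by apply: ordered_sorted;
    [exact: prec_trans|exact: prec_irr|exact: (@same_sign_total _ _ b)].
apply: ordered_unique; [exact: prec_trans|exact: prec_irr| | |].
- apply: (@same_sign_total _ _ b) => // h; rewrite AE inE.
  by case/orP=> /imsetP[x xA ->]; [apply: b1|apply: b2].
- rewrite (sorted_pairwise (prec_trans Tp)) pairwise_cat !pairwise_map.
  apply/and3P; split.
  + by apply/allrelP => _ _ /mapP[x _ ->] /mapP[y _ ->].
  + by rewrite -(sorted_pairwise (prec_trans G1p)).
  by rewrite -(sorted_pairwise (prec_trans G2p)).
move=> h; rewrite mem_cat AE in_setU; congr orb.
  apply/idP/idP => [/mapP[x xA ->]|/imsetP[x xA ->]].
    by rewrite imset_f // -mem_ordered.
  by rewrite map_f // mem_ordered.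
apply/idP/idP => [/mapP[x xA ->]|/imsetP[x xA ->]].
  by rewrite imset_f // -mem_ordered.
by rewrite map_f // mem_ordered.
Qed.

Lemma inl_in_inr x (A : {set half G2}) : (inl' x \in inr' @: A) = false.
Proof. by apply/negP => /imsetP[]. Qed.

Lemma inr_in_inl x (A : {set half G1}) : (inr' x \in inl' @: A) = false.
Proof. by apply/negP => /imsetP[]. Qed.

Lemma tensor_graph_in :
  graph_in T = inl' @: graph_in G1 :|: inr' @: graph_in G2.
Proof.
apply/setP => -[x|x]; rewrite in_setU inE /leg.
  rewrite (tensor_virtuall x) (inl_in_inr x) orbF.
  by rewrite (mem_imset _ x inl'_inj) inE.
rewrite (tensor_virtualr x) (inr_in_inl x) /=.
by rewrite (mem_imset _ x inr'_inj) inE.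
Qed.

Lemma tensor_graph_out :
  graph_out T = inl' @: graph_out G1 :|: inr' @: graph_out G2.
Proof.
apply/setP => -[x|x]; rewrite in_setU inE /leg.
  rewrite (tensor_virtuall x) (inl_in_inr x) orbF.
  by rewrite (mem_imset _ x inl'_inj) inE.
rewrite (tensor_virtualr x) (inr_in_inl x) /=.
by rewrite (mem_imset _ x inr'_inj) inE.
Qed.

Lemma tensor_ins : ins T = map inl' (ins G1) ++ map inr' (ins G2).
Proof.
by apply: (@tensor_ordered true) tensor_graph_in => h; rewrite inE => /andP[].
Qed.

Lemma tensor_outs : outs T = map inl' (outs G1) ++ map inr' (outs G2).
Proof.
by apply: (@tensor_ordered false) tensor_graph_out => h; rewrite inE;
  case/andP => _ /negbTE.
Qed.

Lemma tensor_ordered_inl (v : {set half G1}) (b : bool) :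
  (forall h, h \in v -> pos h = b) ->
  ordered (inl' @: v) = map inl' (ordered v).
Proof.
move=> vb; rewrite (@tensor_ordered b v set0) // => [|h|].
- by rewrite /ordered enum_set0 cats0.
- by rewrite inE.
by rewrite imset0 setU0.
Qed.

Lemma tensor_ordered_inr (v : {set half G2}) (b : bool) :
  (forall h, h \in v -> pos h = b) ->
  ordered (inr' @: v) = map inr' (ordered v).
Proof.
move=> vb; rewrite (@tensor_ordered b set0 v) // => [|h|].
- by rewrite /ordered enum_set0.
- by rewrite inE.
by rewrite imset0 set0U.
Qed.

Lemma preim_inl (v : {set half G1}) : inl' @^-1: (inl' @: v) = v.
Proof. by apply/setP => x; rewrite inE (mem_imset _ x inl'_inj). Qed.

Lemma preim_inr (v : {set half G2}) : inr' @^-1: (inr' @: v) = v.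
Proof. by apply/setP => x; rewrite inE (mem_imset _ x inr'_inj). Qed.

Lemma preim_inlr (v : {set half G2}) : inl' @^-1: (inr' @: v) = set0.
Proof. by apply/setP => x; rewrite !inE inl_in_inr. Qed.

End Tensor.

Lemma tensor_axioms (D : tensor_scheme) (G1 G2 : prediagram D) :
  diagram_axioms G1 -> diagram_axioms G2 -> diagram_axioms (tensor G1 G2).
Proof.
move=> [p1 s1 d1] [p2 s2 d2]; split; first exact: tensor_planar.
  by case=> x /=.
move=> v /tensor_realP[] [w wV ->].
  have [f [fE fs ft]] := d1 w wV; exists f.
  have n0 : w != set0.
    case/setDP: wV => wV _; apply: contraTneq wV => ->.
    by case/and3P: (vertices_partition (planar_graph p1)).
  split.
  - by rewrite /= preim_inl n0.
  - rewrite tensor_vertex_inl (@tensor_ordered_inl _ _ p1 p2 _ true).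
      by rewrite -map_comp fs.
    by move=> h; rewrite inE => /andP[].
  rewrite tensor_vertex_outl (@tensor_ordered_inl _ _ p1 p2 _ false).
    by rewrite -map_comp ft.
  by move=> h; rewrite inE => /andP[_ /negbTE].
have [f [fE fs ft]] := d2 w wV; exists f; split.
- by rewrite /= preim_inlr preim_inr eqxx.
- rewrite tensor_vertex_inr (@tensor_ordered_inr _ _ p1 p2 _ true).
    by rewrite -map_comp fs.
  by move=> h; rewrite inE => /andP[].
rewrite tensor_vertex_outr (@tensor_ordered_inr _ _ p1 p2 _ false).
  by rewrite -map_comp ft.
by move=> h; rewrite inE => /andP[_ /negbTE].
Qed.

Lemma dom_tensor (D : tensor_scheme) (G1 G2 : prediagram D) :
  diagram_axioms G1 -> diagram_axioms G2 ->
  dom (tensor G1 G2) = dom G1 ++ dom G2.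
Proof.
move=> [p1 _ _] [p2 _ _].
by rewrite /dom /= tensor_ins // map_cat -!map_comp.
Qed.

Lemma cod_tensor (D : tensor_scheme) (G1 G2 : prediagram D) :
  diagram_axioms G1 -> diagram_axioms G2 ->
  cod (tensor G1 G2) = cod G1 ++ cod G2.
Proof.
move=> [p1 _ _] [p2 _ _].
by rewrite /cod /= tensor_outs // map_cat -!map_comp.
Qed.

(** * The monad of bracketed diagrams *)

(* [bclass] is an isomorphism class of diagrams. *)
Record bracketed_diagram (D : tensor_scheme) := BracketedDiagram {
  bsrc : seq (seq (Ob D));
  btgt : seq (seq (Ob D));
  bclass : prediagram D -> Prop;
  bsrc_neq0 : bsrc <> [::];
  btgt_neq0 : btgt <> [::];
  bclassP : exists G, [/\ diagram_axioms G, dom G = flatten bsrc,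
                          cod G = flatten btgt & bclass = iso G]
}.

Definition T (D : tensor_scheme) : tensor_scheme :=
  @TensorScheme (seq (Ob D)) (bracketed_diagram D) (@bsrc D) (@btgt D)
    (@bsrc_neq0 D) (@btgt_neq0 D).

Lemma map_neq0 (A B : Type) (f : A -> B) s : s <> [::] -> map f s <> [::].
Proof. by case: s. Qed.

Lemma map_flatten (A B : Type) (f : A -> B) (ss : seq (seq A)) :
  map f (flatten ss) = flatten (map (map f) ss).
Proof. by elim: ss => //= s ss <-; rewrite map_cat. Qed.

Lemma flatten_map_seq1 (A : Type) (s : seq A) :
  flatten [seq [:: x] | x <- s] = s.
Proof. by elim: s => //= x s ->. Qed.

Definition relabel_class (D E : tensor_scheme) (phi : scheme_morphism D E)
    (C : prediagram D -> Prop) : prediagram E -> Prop :=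
  fun G' => exists2 G, C G & iso (relabel phi G) G'.

Lemma relabel_class_iso (D E : tensor_scheme) (phi : scheme_morphism D E)
    (G : prediagram D) : relabel_class phi (iso G) = iso (relabel phi G).
Proof.
apply/funext => G'; apply/propext; split; last by exists G => //; apply: iso_refl.
by case=> K /(relabel_iso phi) GK; apply: iso_trans.
Qed.

Lemma relabel_classP (D E : tensor_scheme) (phi : scheme_morphism D E)
    (X : bracketed_diagram D) :
  exists G, [/\ diagram_axioms G,
    dom G = flatten (map (map (fo phi)) (bsrc X)),
    cod G = flatten (map (map (fo phi)) (btgt X)) &
    relabel_class phi (bclass X) = iso G].
Proof.
have [G [Ga Gd Gc ->]] := bclassP X; exists (relabel phi G); split.
- exact: relabel_axioms.
- by rewrite dom_relabel Gd map_flatten.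
- by rewrite cod_relabel Gc map_flatten.
exact: relabel_class_iso.
Qed.

Definition T_fm (D E : tensor_scheme) (phi : scheme_morphism D E)
    (X : bracketed_diagram D) : bracketed_diagram E :=
  BracketedDiagram (map_neq0 (@bsrc_neq0 D X)) (map_neq0 (@btgt_neq0 D X))
    (relabel_classP phi X).

Definition T_map (D E : tensor_scheme) (phi : scheme_morphism D E) :
    scheme_morphism (T D) (T E) :=
  @SchemeMorphism (T D) (T E) (map (fo phi)) (T_fm phi)
    (fun=> erefl) (fun=> erefl).

(* The bracketed diagram ((x_1)...(x_m); (y_1)...(y_n); G), all brackets being
   one-letter words. *)
Definition discrete (D : tensor_scheme) (xs ys : seq (Ob D))
    (G : prediagram D) (xs0 : xs <> [::]) (ys0 : ys <> [::])
    (Ga : diagram_axioms G) (Gd : dom G = xs) (Gc : cod G = ys) : Mor (T D) :=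
  @BracketedDiagram D [seq [:: x] | x <- xs] [seq [:: y] | y <- ys] (iso G)
    (map_neq0 xs0) (map_neq0 ys0)
    (ex_intro _ G (And4 Ga (etrans Gd (esym (flatten_map_seq1 xs)))
                          (etrans Gc (esym (flatten_map_seq1 ys))) erefl)).

Definition eta_fm (D : tensor_scheme) (f : Mor D) : Mor (T D) :=
  discrete (@src_neq0 D f) (@tgt_neq0 D f) (prime_axioms f)
    (dom_prime f) (cod_prime f).

Definition eta (D : tensor_scheme) : scheme_morphism D (T D) :=
  @SchemeMorphism D (T D) (fun x => [:: x]) (@eta_fm D)
    (fun=> erefl) (fun=> erefl).

(* [value X G]: the diagram [G] is the value of the diagram [X] of diagrams,
   i.e. if [X] is built from unitary and prime diagrams by tensor products and
   compositions, then [G] is built in the same way from the identities of the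
   words decorating the edges and the diagrams decorating the vertices. *)
Inductive value (D : tensor_scheme) : prediagram (T D) -> prediagram D -> Prop :=
| value_empty : value (empty_diagram (T D)) (empty_diagram D)
| value_unitary (w : seq (Ob D)) : value (@unitary (T D) w) (idw w)
| value_prime (f : Mor (T D)) (G : prediagram D) :
    bclass f G -> value (prime_diagram f) G
| value_tensor X1 X2 G1 G2 :
    value X1 G1 -> value X2 G2 -> value (tensor X1 X2) (tensor G1 G2)
| value_compose X1 X2 G1 G2 :
    value X1 G1 -> value X2 G2 -> cod X1 = dom X2 ->
    value (compose X2 X1) (compose G2 G1)
| value_iso X X' G G' :
    value X G -> iso X X' -> iso G G' -> value X' G'.

Definition mu_fo (D : tensor_scheme) : Ob (T (T D)) -> Ob (T D) :=
  @flatten (Ob D).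

(* The graph of the map mu on morphisms: F(T D) is the free strict monoidal
   category on T D, so every diagram in T D has exactly one value up to
   isomorphism. *)
Definition mu_fm (D : tensor_scheme) (X : Mor (T (T D))) (M : Mor (T D)) : Prop :=
  [/\ src M = [seq mu_fo W | W <- src X],
      tgt M = [seq mu_fo W | W <- tgt X] &
      exists X0 G0, [/\ bclass X X0, bclass M G0 & value X0 G0]].

Record tensor_manifold (D : tensor_scheme)
    (eps : scheme_morphism (T D) D) : Prop := TensorManifold {
  eps_mu_o : forall W : Ob (T (T D)),
    fo eps (fo (T_map eps) W) = fo eps (mu_fo W);
  eps_mu_m : forall (X : Mor (T (T D))) (M : Mor (T D)), mu_fm X M ->
    fm eps (fm (T_map eps) X) = fm eps M;
  eps_eta_o : forall x : Ob D, fo eps (fo (eta D) x) = x;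
  eps_eta_m : forall f : Mor D, fm eps (fm (eta D) f) = f
}.

Lemma cat_neq0 (A : Type) (s1 s2 : seq A) : s1 <> [::] -> s1 ++ s2 <> [::].
Proof. by case: s1. Qed.

Lemma dom_tensor_prime (D : tensor_scheme) (f g : Mor D) :
  dom (tensor (prime_diagram f) (prime_diagram g)) = src f ++ src g.
Proof. by rewrite dom_tensor ?dom_prime //; apply: prime_axioms. Qed.

Lemma cod_tensor_prime (D : tensor_scheme) (f g : Mor D) :
  cod (tensor (prime_diagram f) (prime_diagram g)) = tgt f ++ tgt g.
Proof. by rewrite cod_tensor ?cod_prime //; apply: prime_axioms. Qed.

Definition otimes (D : tensor_scheme) (eps : scheme_morphism (T D) D)
    (f g : Mor D) : Mor D :=
  fm eps (discrete (cat_neq0 (s2 := src g) (@src_neq0 D f))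
                   (cat_neq0 (s2 := tgt g) (@tgt_neq0 D f))
                   (tensor_axioms (prime_axioms f) (prime_axioms g))
                   (dom_tensor_prime f g) (cod_tensor_prime f g)).

(* Main.v *)
From mathcomp Require Import all_boot boolp.
Require Import Defs.

(** On morphisms of T(D) there is a tensor product [btensor]: concatenate the
    brackets and tensor the diagrams.  It is associative for the same reason as
    the tensor product of planar graphs: the reassociation of disjoint unions
    is an isomorphism, and the brackets are words ([btensorA]).

    The structure map of a tensor manifold sends [btensor] to [otimes]
    ([eps_btensor]).  Indeed, [otimes eps f g] is
    eps(eta f # eta g), where # is [btensor] ([otimesE]).  For bracketed diagrams X, Y the
    element eta X # eta Y of TT(D) is a pair of prime vertices decorated by X
    and Y, so mu sends it to X # Y ([mu_btensor]), while T(eps) sends it to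
    eta(eps X) # eta(eps Y), because # commutes with relabelling ([T_btensor])
    and eta is natural ([eta_natural]).  The law that eps o mu = eps o T(eps)
    therefore reads eps(X # Y) = eps X (x) eps Y,
    where (x) is [otimes eps].

    Since eps o eta = id, every morphism of D lies in the image of eps, and
    associativity of (x) is the image under eps of associativity of #. *)

Set Implicit Arguments.
Unset Strict Implicit.
Unset Printing Implicit Defensive.

(** * Tensor product of diagrams up to isomorphism *)

Section SumMap.

Variables (A B A' B' : finType) (f : A -> A') (g : B -> B').

Definition sum_map (h : A + B) : A' + B' :=
  match h with inl x => inl (f x) | inr y => inr (g y) end.

Lemma sum_map_bij : bijective f -> bijective g -> bijective sum_map.
Proof.
case=> f' fK f'K [g' gK g'K].
by exists (fun h => match h with inl x => inl (f' x) | inr y => inr (g' y) end);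
  case=> x /=; rewrite ?fK ?f'K ?gK ?g'K.
Qed.

Lemma sum_map_inl (v : {set A}) :
  sum_map @: (inl @: v) = inl @: (f @: v).
Proof. by rewrite -!imset_comp. Qed.

Lemma sum_map_inr (v : {set B}) :
  sum_map @: (inr @: v) = inr @: (g @: v).
Proof. by rewrite -!imset_comp. Qed.

End SumMap.

(** The decoration of a tensor product tells the two sides apart by whether a
    vertex meets the left one, so an empty vertex of [G1] would be read on the
    right; the axioms on [G1] exclude it. *)
Lemma tensor_iso (D : tensor_scheme) (G1 G2 G1' G2' : prediagram D) :
  diagram_axioms G1 -> iso G1 G1' -> iso G2 G2' ->
  iso (tensor G1 G2) (tensor G1' G2').
Proof.
move=> G1a [f [fb [fV [fs [fp [fr [fc fd]]]]]]].
case=> g [gb [gV [gs [gp [gr [gc gd]]]]]].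
exists (sum_map f g); split; first exact: sum_map_bij.
split.
  rewrite /= imsetU -!imset_comp -fV -gV -!imset_comp.
  by congr setU; apply: eq_imset => v; rewrite /= (sum_map_inl, sum_map_inr).
split; first by case=> x /=; rewrite (fs, gs).
split; first by case=> x /=.
split; first by case=> x [] y /=.
split; first by case=> x /=.
move=> v /tensor_realP[] [w wr ->] /=.
  rewrite sum_map_inl !preim_inl.
  have w0 : w != set0.
    case/setDP: wr => wV _; apply: contraTneq wV => ->.
    by case/and3P: (vertices_partition (planar_graph (diagram_planar G1a))).
  by rewrite imset_eq0 w0 fd.
by rewrite sum_map_inr !preim_inlr !preim_inr !eqxx gd.
Qed.

Section SumAssoc.

Variables A B C : Type.

Definition sum_assoc (h : A + (B + C)) : (A + B) + C :=
  match h with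
  | inl x => inl (inl x)
  | inr (inl y) => inl (inr y)
  | inr (inr z) => inr z
  end.

Lemma sum_assoc_bij : bijective sum_assoc.
Proof.
exists (fun h => match h with
  | inl (inl x) => inl x
  | inl (inr y) => inr (inl y)
  | inr z => inr (inr z)
  end); [by case=> [x|[y|z]]|by case=> [[x|y]|z]].
Qed.

End SumAssoc.

Lemma tensorA (D : tensor_scheme) (G1 G2 G3 : prediagram D) :
  iso (tensor G1 (tensor G2 G3)) (tensor (tensor G1 G2) G3).
Proof.
pose f : half (tensor G1 (tensor G2 G3)) -> half (tensor (tensor G1 G2) G3) :=
  @sum_assoc (half G1) (half G2) (half G3).
have fb : bijective f := sum_assoc_bij _ _ _.
have fi := bij_inj fb.
exists f; split => //; split.
  rewrite /= !imsetU setUA -!imset_comp.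
  congr (_ :|: _ :|: _); apply: eq_imset => v /=; by rewrite -!imset_comp.
split; first by case=> [x|[x|x]].
split; first by case=> [x|[x|x]].
split; first by case=> [x|[x|x]] [y|[y|y]].
split; first by case=> [x|[x|x]].
move=> v _ /=.
(* The three components of a vertex are the same on both sides; only the order
   of the tests that choose between them differs. *)
have E1 : inl @^-1: (inl @^-1: (f @: v)) = inl @^-1: v.
  by apply/setP => x; rewrite !inE -(mem_imset v (inl x) fi).
have E2 : inr @^-1: (inl @^-1: (f @: v)) = inl @^-1: (inr @^-1: v).
  by apply/setP => x; rewrite !inE -(mem_imset v (inr (inl x)) fi).
have E3 : inr @^-1: (f @: v) = inr @^-1: (inr @^-1: v).
  by apply/setP => x; rewrite !inE -(mem_imset v (inr (inr x)) fi).
rewrite E1 E2 E3.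
have -> : (inl @^-1: (f @: v) != set0) =
    (inl @^-1: v != set0) || (inl @^-1: (inr @^-1: v) != set0).
  rewrite -E1 -E2; apply/set0Pn/orP.
    case=> -[x|x] xv; [left|right]; apply/set0Pn; exists x; by rewrite inE.
  by case=> /set0Pn[x]; rewrite inE => xv; [exists (inl x)|exists (inr x)].
by case: eqP; case: eqP.
Qed.

(** * Compatibility with relabelling *)

Lemma relabel_tensor (D E : tensor_scheme) (phi : scheme_morphism D E)
    (G1 G2 : prediagram D) :
  relabel phi (tensor G1 G2) = tensor (relabel phi G1) (relabel phi G2).
Proof.
rewrite /relabel /tensor; congr Prediagram; apply/funext; first by case.
by move=> v /=; case: ifP.
Qed.

Lemma tnth_cast_map (A B : Type) (F : A -> B) (s : seq A) (t : seq B)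
    (e : size s = size t) (i : 'I_(size s)) :
  t = map F s -> tnth (in_tuple t) (cast_ord e i) = F (tnth (in_tuple s) i).
Proof.
move=> tE; set x0 := tnth (in_tuple s) i.
by rewrite (tnth_nth (F x0)) /= tE (nth_map x0) // /x0 [in RHS](tnth_nth x0).
Qed.

(** This is an isomorphism and not an equality because the half-edges of a prime
    diagram are indexed by the positions in the source and target words: the
    words of [f] and [fm phi f] have the same length only propositionally. *)
Lemma relabel_prime (D E : tensor_scheme) (phi : scheme_morphism D E)
    (f : Mor D) :
  iso (relabel phi (prime_diagram f)) (prime_diagram (fm phi f)).
Proof.
have es : size (src f) = size (src (fm phi f)) by rewrite src_fm size_map.
have et : size (tgt f) = size (tgt (fm phi f)) by rewrite tgt_fm size_map.
pose c : half (prime_diagram f) -> half (prime_diagram (fm phi f)) :=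
  sum_map (cast_ord es) (cast_ord et).
have cb : bijective c.
  apply: sum_map_bij; [exists (cast_ord (esym es))|exists (cast_ord (esym et))];
    by move=> i; apply: val_inj.
exists c; split => //; split.
  rewrite /= imset_set1; congr [set _]; apply/setP => x; rewrite inE.
  by case: cb => c' _ c'K; apply/imsetP; exists (c' x); rewrite ?inE ?c'K.
split; first by case.
split; first by case.
split; first by case=> i [] j.
by split=> // -[i|j] /=; apply: tnth_cast_map; rewrite (src_fm, tgt_fm).
Qed.

(** * Tensor product of bracketed diagrams *)

Section BracketedTensor.

Variable D : tensor_scheme.
Implicit Types X Y Z : Mor (T D).

Lemma bracketed_eq X Y :
  bsrc X = bsrc Y -> btgt X = btgt Y -> bclass X = bclass Y -> X = Y.
Proof.
case: X Y => [s t C ? ? ?] [s' t' C' ? ? ?] /= es et eC.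
by subst; congr BracketedDiagram; apply: Prop_irrelevance.
Qed.

(** Defined on all representatives at once, so that nothing has to be chosen;
    by [tensor_class_iso] any one pair of diagrams determines it. *)
Definition tensor_class (C1 C2 : prediagram D -> Prop) : prediagram D -> Prop :=
  fun K => exists G1 G2, [/\ C1 G1, C2 G2 & iso (tensor G1 G2) K].

Lemma tensor_class_iso (G1 G2 : prediagram D) : diagram_axioms G1 ->
  tensor_class (iso G1) (iso G2) = iso (tensor G1 G2).
Proof.
move=> G1a; apply/funext => K; apply/propext; split.
  case=> H1 [H2 [G1H G2H]]; apply: iso_trans; exact: tensor_iso.
by exists G1, G2; split=> //; apply: iso_refl.
Qed.

Lemma tensor_classP X Y : exists G,
  [/\ diagram_axioms G, dom G = flatten (bsrc X ++ bsrc Y),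
      cod G = flatten (btgt X ++ btgt Y) &
      tensor_class (bclass X) (bclass Y) = iso G].
Proof.
have [G [Ga Gd Gc ->]] := bclassP X; have [H [Ha Hd Hc ->]] := bclassP Y.
exists (tensor G H); split; last exact: tensor_class_iso.
- exact: tensor_axioms.
- by rewrite dom_tensor // Gd Hd flatten_cat.
by rewrite cod_tensor // Gc Hc flatten_cat.
Qed.

Definition btensor X Y : Mor (T D) :=
  BracketedDiagram (cat_neq0 (s2 := bsrc Y) (@bsrc_neq0 D X))
    (cat_neq0 (s2 := btgt Y) (@btgt_neq0 D X)) (tensor_classP X Y).

Lemma btensorA X Y Z : btensor X (btensor Y Z) = btensor (btensor X Y) Z.
Proof.
apply: bracketed_eq; rewrite /= ?catA //.
have [GX [GXa _ _ ->]] := bclassP X; have [GY [GYa _ _ ->]] := bclassP Y.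
have [GZ [_ _ _ ->]] := bclassP Z.
rewrite !tensor_class_iso //; last exact: tensor_axioms.
exact/iso_class/tensorA.
Qed.

Lemma otimesE (eps : scheme_morphism (T D) D) (f g : Mor D) :
  otimes eps f g = fm eps (btensor (fm (eta D) f) (fm (eta D) g)).
Proof.
congr (fm eps _); apply: bracketed_eq; rewrite /= ?map_cat //.
by rewrite tensor_class_iso //; apply: prime_axioms.
Qed.

End BracketedTensor.

(** * The structure map of a tensor manifold *)

(** A diagram with two prime vertices side by side is evaluated by tensoring the
    diagrams that decorate them; concatenating the one-letter brackets of
    [eta] gives back the brackets of [X] and [Y]. *)
Lemma mu_btensor (D : tensor_scheme) (X Y : Mor (T D)) :
  mu_fm (btensor (fm (eta (T D)) X) (fm (eta (T D)) Y)) (btensor X Y).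
Proof.
have [G [Ga _ _ XG]] := bclassP X; have [H [_ _ _ YH]] := bclassP Y.
have single (s : seq (seq (Ob D))) :
    [seq flatten w | w <- [seq [:: x] | x <- s]] = s.
  by elim: s => //= x s ->; rewrite cats0.
split; rewrite /= ?map_cat ?single //.
exists (tensor (prime_diagram X) (prime_diagram Y)), (tensor G H); split.
- by rewrite tensor_class_iso; [apply: iso_refl|apply: prime_axioms].
- by rewrite XG YH tensor_class_iso //; apply: iso_refl.
by apply: value_tensor; apply: value_prime; rewrite ?XG ?YH; apply: iso_refl.
Qed.

Lemma eta_natural (D E : tensor_scheme) (phi : scheme_morphism D E) (f : Mor D) :
  fm (T_map phi) (fm (eta D) f) = fm (eta E) (fm phi f).
Proof.
apply: bracketed_eq; rewrite /= ?src_fm ?tgt_fm -?map_comp //.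
by rewrite relabel_class_iso; apply/iso_class/relabel_prime.
Qed.

Lemma T_btensor (D E : tensor_scheme) (phi : scheme_morphism D E)
    (X Y : Mor (T D)) :
  fm (T_map phi) (btensor X Y) =
  btensor (fm (T_map phi) X) (fm (T_map phi) Y).
Proof.
apply: bracketed_eq; rewrite /= ?map_cat //.
have [G [Ga _ _ ->]] := bclassP X; have [H [_ _ _ ->]] := bclassP Y.
rewrite tensor_class_iso // !relabel_class_iso tensor_class_iso.
  by rewrite relabel_tensor.
exact: relabel_axioms.
Qed.

(** The associativity law of the algebra, evaluated at the element
    [btensor (eta X) (eta Y)] of TT(D). *)
Lemma eps_btensor (D : tensor_scheme) (eps : scheme_morphism (T D) D)
    (Deps : tensor_manifold eps) (X Y : Mor (T D)) :
  fm eps (btensor X Y) = otimes eps (fm eps X) (fm eps Y).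
Proof.
rewrite -(eps_mu_m Deps (mu_btensor X Y)) T_btensor !eta_natural.
by rewrite otimesE.
Qed.

Theorem proposition6p2p1 (D : tensor_scheme) (eps : scheme_morphism (T D) D)
    (Deps : tensor_manifold eps) (f g h : Mor D) :
  otimes eps f (otimes eps g h) = otimes eps (otimes eps f g) h.
Proof.
rewrite -(eps_eta_m Deps f) -(eps_eta_m Deps g) -(eps_eta_m Deps h).
by rewrite -!eps_btensor // btensorA.
Qed.
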